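(* Let $\lambda$ be a partition of a positive integer, let $t\geq\ell(\lambda)$ be an integer, and let $M_\lambda$ be the $t\times t$ matrix over $\mathbb{Q}(q)[y]$ (with $q,y$ indeterminates) given by $M_\lambda=[g(\lambda_i-i+j)]_{i,j=1}^t$, where $$g(k)=\frac{(1-y)(1-qy)(1-q^2y)\cdots(1-q^{k-1}y)}{(1-q)(1-q^2)\cdots(1-q^k)}\quad (k\geq 1),\qquad g(0)=1,\qquad g(k)=0\quad (k<0).$$ Let the Smith normal form of $M_\lambda$ over the ring $\mathbb{Q}(q)[y]$ have main diagonal $(\beta_1,\beta_2,\dots,\beta_t)$. Then we can take $$\beta_i=\prod_{u\in D_{t-i+1}}(1-q^{c(u)}y),\qquad 1\leq i\leq t,$$ where $D_k$ is the $k$th diagonal hook of $\lambda$ and $c(u)$ is the content of the square $u$. That is, the diagonal matrix with these diagonal entries is a Smith normal form of $M_\lambda$ over $\mathbb{Q}(q)[y]$.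
   Context: A partition $\lambda=(\lambda_1\geq\lambda_2\geq\cdots)$ has length $\ell(\lambda)$, its number of nonzero parts; set $\lambda_i=0$ for $i>\ell(\lambda)$. Identify $\lambda$ with its Young diagram, the set of squares $(i,j)$ with $1\leq i\leq\ell(\lambda)$, $1\leq j\leq\lambda_i$. The content of the square $u=(i,j)$ is $c(u)=j-i$. The $k$th diagonal hook $D_k$ ($k\geq 1$) of $\lambda$ is the set of all squares $(i,j)\in\lambda$ such that either $i=k$ and $j\geq k$, or $j=k$ and $i\geq k$ (possibly empty). An empty product equals $1$. The matrix $M_\lambda$ is obtained from the Jacobi-Trudi matrix $\mathrm{JT}_\lambda=[h_{\lambda_i+j-i}]_{i,j=1}^t$ (with $h_m$ the complete homogeneous symmetric function of degree $m$, $h_0=1$, $h_m=0$ for $m<0$) by the specialization $x_i=q^{i-1}$ for $1\leq i\leq n$, $x_i=0$ for $i>n$, and then substituting $q^n=y$; thus $g(k)$ is the result of writing $h_k(1,q,\dots,q^{n-1})$ in terms of $q$ and $q^n$ and setting $q^n=y$. A Smith normal form of a nonsingular $t\times t$ matrix $M$ over a commutative ring $R$ is a diagonal matrix $PMQ$, with $P,Q$ invertible $t\times t$ matrices over $R$, whose diagonal entries $\beta_1,\dots,\beta_t$ satisfy $\beta_i\mid\beta_{i+1}$ in $R$ for $1\leq i\leq t-1$. Over a principal ideal domain it exists and its diagonal entries are unique up to multiplication by units; ''we can take'' refers to this freedom. *)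

(* Defs.v *)
From mathcomp Require Import all_boot all_order all_algebra.

Set Implicit Arguments.
Unset Strict Implicit.
Unset Printing Implicit Defensive.

Import GRing.Theory.
Local Open Scope ring_scope.

(* A partition is its sequence of nonzero parts, so its length is [size la]. *)
Definition is_partition_of (n : nat) (la : seq nat) : bool :=
  [&& sorted geq la, 0%N \notin la & sumn la == n].

(* Rows, columns, parts and diagonal hooks are numbered from 1; [part la 0] is
   a junk value. *)
Definition part (la : seq nat) (i : nat) : nat := nth 0%N la i.-1.

(* The squares are listed without repetition. *)
Definition young_diagram (la : seq nat) : seq (nat * nat) :=
  [seq (i, j) | i <- iota 1 (size la), j <- iota 1 (part la i)].

Definition content (u : nat * nat) : int := u.2%:Z - u.1%:Z.

Definition diag_hook (la : seq nat) (k : nat) : seq (nat * nat) :=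
  [seq u <- young_diagram la |
     (u.1 == k) && (k <= u.2)%N || (u.2 == k) && (k <= u.1)%N].

Notation Qq := {fraction {poly rat}}.

Definition q : Qq := FracField.tofrac ('X : {poly rat}).

Definition y : {poly Qq} := 'X.

(* The denominator lies in the field Q(q), so dividing by it is scaling by its
   inverse; for [k = 0] both products are empty. *)
Definition g (k : int) : {poly Qq} :=
  match k with
  | Posz m => (\prod_(1 <= i < m.+1) (1 - q ^+ i))^-1 *:
                \prod_(0 <= i < m) (1 - q ^+ i *: y)
  | Negz _ => 0
  end.

(* The ordinals [i] and [j] start at 0, hence the successors. *)
Definition jt_matrix (la : seq nat) (t : nat) : 'M[{poly Qq}]_t :=
  \matrix_(i < t, j < t) g ((part la i.+1)%:Z - (i.+1)%:Z + (j.+1)%:Z).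

Definition hook_prod (la : seq nat) (k : nat) : {poly Qq} :=
  \prod_(u <- diag_hook la k) (1 - q ^ content u *: y).

Definition ring_divides (R : comUnitRingType) (a b : R) : Prop :=
  exists c : R, b = c * a.

(* Smith normal forms are considered for nonsingular matrices only, so
   nonsingularity of [M] is part of the definition. *)
Definition is_smith_normal_form (R : comUnitRingType) (t : nat)
    (M D : 'M[R]_t) : Prop :=
  [/\ \det M != 0,
      is_diag_mx D,
      exists P Q : 'M[R]_t,
        [/\ P \in unitmx, Q \in unitmx & D = P *m M *m Q]
    & forall i j : 'I_t, j = i.+1 :> nat -> ring_divides (D i i) (D j j)].

(* Main.v *)
Require Import Defs.
From mathcomp Require Import all_boot all_order all_algebra.
From mathcomp Require Import perm zify.
From Stdlib Require Import Classical.

(** Write [M] for the Jacobi-Trudi matrix and [h_i] for the product over the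
    diagonal hook [D_(t - i)], with [i] counted from 0.  The ring Q(q)[y] is a
    principal ideal domain, so [M] has some Smith normal form [(e_i)]
    ([smith_poly]); the point is to identify [e_i] with [h_i].

    A diagonal hook contains at most one square of each content, and
    [1 - q^c y] vanishes exactly at [y = q^(-c)].  Hence [h_i] is, up to a
    constant, a product of distinct linear factors, and [h_i] divides [e_i] as
    soon as [e_i] vanishes at [q^(-c)] for every content [c] in [D_(t - i)].
    If it did not, then neither would its divisors [e_0, ..., e_i], and
    [M(q^(-c))] would have rank greater than [i].  So the divisibility follows
    from a rank drop ([rank_jt_root]): if [D_k] has a square of content [c],
    then [M(q^(-c))] has rank at most [t - k].  There are two cases.
    - For [c >= 0], the entry [g(m)] has the factor [1 - q^c y] when [m > c],
      and the first [k] rows of [M] contain only such entries.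
    - For [c = - d < 0], the value [g(m)(q^d)] is h_m(1, q, ..., q^(d - 1)),
      the q-binomial coefficient of [m + d - 1] over [d - 1].  As long as
      [m > - d] it is a polynomial of degree less than [d] in [q^m]
      ([g_q_binomial]), so that rows with only such indices span a space of
      dimension at most [d].  The first [k + d] rows are of that kind, and
      the other rows add at most [t - k - d].

    Equality then comes from degrees.  The hooks partition the diagram, so the
    product of the [h_i] has degree [|la|]; the determinant of [M], which is
    the product of the [e_i] up to a constant, has degree at most [|la|]
    because [g(m)] has degree [m] and row and column shifts cancel along each
    permutation.  Provided the determinant is nonzero, every quotient
    [e_i / h_i] is a constant ([smith_of_ranks]).

    The determinant is nonzero because it is so at [y = 0]: there, up to row
    factors, the entries are polynomials of degrees [t - 1, ..., 1, 0]
    evaluated at the distinct points [q^(la_i - i + t)], and the matrix is a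
    Vandermonde matrix up to a triangular factor ([det_jt_neq0]). *)

Set Implicit Arguments.
Unset Strict Implicit.
Unset Printing Implicit Defensive.
Import Order.TTheory GRing.Theory Num.Theory.
Local Open Scope ring_scope.

(** * Smith normal forms over F[X] *)

Definition mx_equiv (R : comUnitRingType) (t : nat) (A M : 'M[R]_t) : Prop :=
  exists P Q : 'M[R]_t, [/\ P \in unitmx, Q \in unitmx & A = P *m M *m Q].

Lemma mx_equiv_refl (R : comUnitRingType) t (M : 'M[R]_t) : mx_equiv M M.
Proof. by exists 1%:M, 1%:M; rewrite unitmx1 mul1mx mulmx1. Qed.

Lemma mx_equiv_mul (R : comUnitRingType) t (A M P Q : 'M[R]_t) :
  P \in unitmx -> Q \in unitmx -> mx_equiv A M -> mx_equiv (P *m A *m Q) M.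
Proof.
move=> uP uQ [P' [Q' [uP' uQ' ->]]]; exists (P *m P'), (Q' *m Q).
by rewrite !unitmx_mul uP uQ uP' uQ' !mulmxA.
Qed.

Lemma mx_equiv_mull (R : comUnitRingType) t (A M P : 'M[R]_t) :
  P \in unitmx -> mx_equiv A M -> mx_equiv (P *m A) M.
Proof.
by move=> uP eA; rewrite -[P *m A]mulmx1; apply: mx_equiv_mul; rewrite ?unitmx1.
Qed.

Lemma mx_equiv_mulr (R : comUnitRingType) t (A M Q : 'M[R]_t) :
  Q \in unitmx -> mx_equiv A M -> mx_equiv (A *m Q) M.
Proof.
by move=> uQ eA; rewrite -[A]mul1mx; apply: mx_equiv_mul; rewrite ?unitmx1.
Qed.

Section BlockShears.
Variables (R : comUnitRingType) (m n : nat).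
Lemma unitmx_lshear (c : 'M[R]_(n, m)) : block_mx 1%:M 0 c 1%:M \in unitmx.
Proof. by rewrite unitmxE det_lblock !det1 mulr1 unitr1. Qed.
Lemma unitmx_ushear (r : 'M[R]_(m, n)) : block_mx 1%:M r 0 1%:M \in unitmx.
Proof. by rewrite unitmxE det_ublock !det1 mulr1 unitr1. Qed.
End BlockShears.

Section Smith.
Variable F : fieldType.

(* [d] has least size among the nonzero entries of all the matrices equivalent
   to [M].  Whenever [d] can be made the corner entry, every remainder modulo
   [d] that row and column operations produce must therefore vanish. *)
Section Pivot.
Variables (t : nat) (M : 'M[{poly F}]_(1 + t)) (d : {poly F}).
Hypothesis d_neq0 : d != 0.
Hypothesis d_min : forall A i j,
  mx_equiv A M -> A i j != 0 -> (size d <= size (A i j))%N.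

Lemma pivot_dvd_col r c B :
  mx_equiv (block_mx d%:M r c B) M -> forall i, d %| c i 0.
Proof.
move=> eA i; apply/negPn/negP; rewrite /dvdp => nz.
have := mx_equiv_mull (unitmx_lshear (- map_mx (fun p => p %/ d) c)) eA.
rewrite mulmx_block => /d_min min_d.
move: (min_d (rshift 1 i) (lshift t 0)).
rewrite block_mxEdl !mul1mx mulNmx mul_mx_scalar !mxE.
have -> : - (d * (c i 0 %/ d)) + c i 0 = c i 0 %% d.
  by rewrite {2}[c i 0](divp_eq _ d) mulrC addKr.
by move/(_ nz); rewrite leqNgt ltn_modp d_neq0.
Qed.

Lemma pivot_dvd_row r c B :
  mx_equiv (block_mx d%:M r c B) M -> forall j, d %| r 0 j.
Proof.
move=> eA j; apply/negPn/negP; rewrite /dvdp => nz.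
have := mx_equiv_mulr (unitmx_ushear (- map_mx (fun p => p %/ d) r)) eA.
rewrite mulmx_block => /d_min min_d.
move: (min_d (lshift t 0) (rshift 1 j)).
rewrite block_mxEur !mulmx1 mulmxN mul_scalar_mx !mxE.
have -> : - (d * (r 0 j %/ d)) + r 0 j = r 0 j %% d.
  by rewrite {2}[r 0 j](divp_eq _ d) mulrC addKr.
by move/(_ nz); rewrite leqNgt ltn_modp d_neq0.
Qed.

(** Adding row [i] of the lower block to the pivot row reduces the claim to
    divisibility along the pivot row. *)
Lemma pivot_dvd_rest B :
  mx_equiv (block_mx d%:M 0 0 B) M -> forall i j, d %| B i j.
Proof.
move=> eA i j.
have := mx_equiv_mull (unitmx_ushear (delta_mx (0 : 'I_1) i)) eA.
rewrite mulmx_block !(mulmx0, mul0mx, mul1mx, addr0, add0r) => eA'.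
by have := pivot_dvd_row eA' j; rewrite -rowE mxE.
Qed.

Lemma pivot_clear A : mx_equiv A M -> A 0 0 = d ->
  exists B, mx_equiv (block_mx d%:M 0 0 B) M /\ forall i j, d %| B i j.
Proof.
move=> eA A00.
have A_blk : A = block_mx d%:M (ursubmx A) (dlsubmx A) (drsubmx A).
  rewrite -{1}[A]submxK; congr block_mx; apply/matrixP => i j.
  by rewrite !ord1 !mxE /= lshift0 -A00.
move: (ursubmx A) (dlsubmx A) (drsubmx A) A_blk => r c B A_blk.
rewrite {}A_blk in eA *.
have dc := pivot_dvd_col eA.
have := mx_equiv_mull (unitmx_lshear (- map_mx (fun p => p %/ d) c)) eA.
rewrite mulmx_block !mul1mx !mul0mx !addr0 => eA'.
have c0 : - map_mx (fun p => p %/ d) c *m d%:M + c = 0.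
  apply/matrixP => i j; rewrite mulNmx mul_mx_scalar !mxE !ord1.
  by rewrite mulrC divpK ?dc // addNr.
rewrite c0 in eA'; move: eA' => {c0}.
set B' := _ + B; clearbody B' => eA'.
have dr := pivot_dvd_row eA'.
have := mx_equiv_mulr (unitmx_ushear (- map_mx (fun p => p %/ d) r)) eA'.
rewrite mulmx_block !(mulmx1, mulmx0, mul0mx, addr0, add0r).
have -> : d%:M *m - map_mx (fun p => p %/ d) r + r = 0.
  apply/matrixP => i j; rewrite mulmxN mul_scalar_mx !mxE !ord1.
  by rewrite mulrC divpK ?dr // addNr.
by move=> eB; exists B'; split => //; apply: pivot_dvd_rest.
Qed.

End Pivot.

(** By induction on the size of the matrix, splitting off a nonzero entry whose
    degree is minimal in the equivalence class: it divides every entry of the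
    complementary block, and so all of its invariant factors. *)
Lemma smith_poly t (M : 'M[{poly F}]_t) :
  exists2 e : 'rV[{poly F}]_t, mx_equiv (diag_mx e) M
    & forall i j : 'I_t, (i <= j)%N -> e 0 i %| e 0 j.
Proof.
elim: t M => [|t IHt].
  move=> M; exists 0 => [|[]//]; rewrite (_ : diag_mx _ = M).
    exact: mx_equiv_refl.
  by apply/matrixP; case.
rewrite -[t.+1]/(1 + t)%N => M.
have [-> | nzM] := eqVneq M 0.
  by exists 0 => [|i j _]; rewrite ?linear0 ?mxE //; apply: mx_equiv_refl.
have [n [A [i [j [eA nzA szA]]]]] : exists n A i j,
    [/\ mx_equiv A M, A i j != 0 & (size (A i j) <= n)%N].
  have /matrix0Pn[i [j nz]] := nzM.
  by exists (size (M i j)), M, i, j; split => //; apply: mx_equiv_refl.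
elim: n A i j eA nzA szA => [|n IHn] A i j eA nzA szA.
  by rewrite leqn0 size_poly_eq0 (negPf nzA) in szA.
(* Either some equivalent matrix has a smaller nonzero entry, or [d] below is
   a pivot. *)
case: (classic (exists A' i' j',
    [/\ mx_equiv A' M, A' i' j' != 0 & (size (A' i' j') <= n)%N])).
  by move=> [A' [i' [j' [? ? ?]]]]; apply: (IHn A' i' j').
move=> noA; set d := A i j in nzA szA.
have d_min A' i' j' : mx_equiv A' M -> A' i' j' != 0 ->
    (size d <= size (A' i' j'))%N.
  move=> eA' nzA'; rewrite leqNgt; apply/negP => lt; apply: noA.
  by exists A', i', j'; split => //; rewrite -ltnS (leq_trans lt).
have [B [eB dB]] : exists B,
    mx_equiv (block_mx d%:M 0 0 B) M /\ forall i j, d %| B i j.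
  apply: (pivot_clear nzA d_min (A := xrow 0 i (xcol 0 j A))).
    rewrite xrowE xcolE mulmxA.
    by apply: mx_equiv_mul; rewrite ?unitmx_perm.
  by rewrite !mxE !tpermL.
have [e [P [Q [uP uQ De]]] e_dvd] := IHt B.
exists (row_mx d%:M e).
  have uP1 : block_mx (1%:M : 'M_1) 0 0 P \in unitmx.
    by rewrite block_diag_mx_unit unitmx1.
  have uQ1 : block_mx (1%:M : 'M_1) 0 0 Q \in unitmx.
    by rewrite block_diag_mx_unit unitmx1.
  have := mx_equiv_mul uP1 uQ1 eB.
  rewrite !mulmx_block !(mulmx1, mulmx0, mul0mx, mul1mx, addr0, add0r) -De.
  by rewrite diag_mx_row (_ : diag_mx d%:M = d%:M) //; apply/matrixP=> a b;
     rewrite !ord1 !mxE.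
have d_e k : d %| e 0 k.
  have -> : e 0 k = diag_mx e k k by rewrite mxE eqxx mulr1n.
  rewrite De !mxE; apply: (big_ind (fun p => d %| p)) => [||l _].
  - exact: dvdp0.
  - exact: dvdp_add.
  apply: dvdp_mulr; rewrite mxE.
  apply: (big_ind (fun p => d %| p)) => [||s _]; first exact: dvdp0.
  - exact: dvdp_add.
  - exact: dvdp_mull.
move=> a b; rewrite !mxE; case: splitP => a' ->; case: splitP => b' ->.
- by rewrite !ord1 !mxE dvdpp.
- by rewrite !ord1 !mxE d_e.
- by rewrite !ord1.
- by rewrite leq_add2l => /e_dvd.
Qed.
End Smith.

Lemma rank_diag_mx_gt (F : fieldType) t (e : 'rV[F]_t) (i : 'I_t) :
  (forall j : 'I_t, (j <= i)%N -> e 0 j != 0) -> (i < \rank (diag_mx e))%N.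
Proof.
move=> nz; rewrite -{1}(@rank_pid_mx F t t i.+1) ?ltn_ord //.
pose inv := \row_j (if (j <= i)%N then (e 0 j)^-1 else 0).
suff -> : pid_mx i.+1 = diag_mx inv *m diag_mx e by apply: mxrankM_maxr.
apply/matrixP => j k; rewrite mul_diag_mx !mxE ltnS val_eqE.
case: eqP => [->|_]; last by rewrite mulr0n mulr0.
by rewrite /= mulr1n; case: ifP => [/nz/mulVf -> //|_]; rewrite mul0r.
Qed.

(** A Smith normal form can be read off from ranks when the expected invariant
    factors are split and squarefree.  If the [i]-th true invariant factor did
    not vanish at [z], neither would the ones before it, which divide it, and
    the evaluation at [z] would have rank greater than [i].  So each [h i]
    divides the true factor, and the bound on the degree of the determinant
    leaves only constants as quotients. *)
Lemma smith_of_ranks (F : fieldType) t (M : 'M[{poly F}]_t)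
    (h : 'I_t -> {poly F}) (rs : 'I_t -> seq F) :
  \det M != 0 -> (size (\det M) <= size (\prod_i h i)%R)%N ->
  (forall i, h i %= \prod_(z <- rs i) ('X - z%:P)) ->
  (forall i, uniq (rs i)) ->
  (forall i z, z \in rs i -> (\rank (map_mx (horner_eval z) M) <= i)%N) ->
  is_smith_normal_form M (diag_mx (\row_i h i)).
Proof.
move=> nzM szM h_rs uniq_rs rank_rs.
have [e [P [Q [uP uQ De]]] e_dvd] := smith_poly M.
have h_dvd i : h i %| e 0 i.
  rewrite (eqp_dvdl _ (h_rs i)); apply: uniq_roots_dvdp; last first.
    by rewrite uniq_rootsE.
  apply/allP => z /rank_rs; apply: contraTT => nz; rewrite -ltnNge.
  have rk : (\rank (map_mx (horner_eval z) (diag_mx e)) <=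
             \rank (map_mx (horner_eval z) M))%N.
    rewrite De !map_mxM.
    by apply: leq_trans (mxrankM_maxl _ _) (mxrankM_maxr _ _).
  apply: leq_trans rk; rewrite map_diag_mx; apply: rank_diag_mx_gt => j le_ji.
  rewrite mxE; apply: contra nz; rewrite -[_ == 0]/(root _ _).
  exact: root_dvdp (e_dvd _ _ le_ji).
have prod_e : size (\prod_i e 0 i) = size (\det M).
  rewrite -det_diag De !det_mulmx mulrC.
  move: uP uQ; rewrite !unitmxE !poly_unitE.
  move=> /andP[/eqP sP _] /andP[/eqP sQ _].
  have nzP : \det P != 0 by rewrite -size_poly_eq0 sP.
  have nzQ : \det Q != 0 by rewrite -size_poly_eq0 sQ.
  by rewrite !size_mul ?mulf_neq0 // sP sQ.
have nz_e : \prod_i e 0 i != 0 by rewrite -size_poly_eq0 prod_e size_poly_eq0.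
pose r i := e 0 i %/ h i.
have e_rh i : e 0 i = r i * h i by rewrite divpK.
have prod_rh : \prod_i e 0 i = (\prod_i r i) * \prod_i h i.
  by rewrite -big_split; apply: eq_bigr => i _; apply: e_rh.
have unit_r i : r i \is a GRing.unit.
  suff /unitr_prodP : \prod_i r i \is a GRing.unit.
    by apply; rewrite ?mem_index_enum.
  move: (nz_e); rewrite prod_rh mulf_eq0 negb_or => /andP[nz_r nz_h].
  move: szM; rewrite -prod_e prod_rh size_mul //.
  rewrite -subn1 leq_subLR leq_add2r => sz_r.
  have sz1 : size (\prod_i r i) = 1%N.
    by apply/eqP; rewrite eqn_leq sz_r lt0n size_poly_eq0.
  rewrite poly_unitE sz1 eqxx unitfE.
  by move: nz_r; rewrite -lead_coef_eq0 lead_coefE sz1.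
split => //.
- exists (diag_mx (\row_i (r i)^-1) *m P), Q; split => //.
    rewrite unitmx_mul uP andbT unitmxE det_diag unitr_prod // => i _.
    by rewrite mxE unitrV.
  rewrite -!mulmxA (mulmxA P) -De mulmx_diag.
  congr diag_mx; apply/rowP => i; rewrite !mxE e_rh mulrA mulVr ?mul1r //.
- move=> i j ij; rewrite !mxE !eqxx !mulr1n.
  have : h i %| h j.
    have : e 0 i %| e 0 j by apply: e_dvd; rewrite ij.
    have assoc k : e 0 k %= h k.
      rewrite e_rh eqp_sym -{1}[h k]mul1r; apply: eqp_mulr.
      rewrite eqp_sym -size_poly_eq1.
      by move: (unit_r k); rewrite poly_unitE => /andP[].
    by rewrite (eqp_dvdl _ (assoc i)) (eqp_dvdr _ (assoc j)).
  by move=> hd; exists (h j %/ h i); rewrite divpK.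
Qed.

(** * The diagram and its diagonal hooks *)

Lemma part_anti la i j : sorted geq la -> (0 < i)%N -> (i <= j)%N ->
  (part la j <= part la i)%N.
Proof.
rewrite /part => la_s i_gt0 le_ij.
have [lt_j|ge_j] := ltnP j.-1 (size la); last by rewrite (nth_default _ ge_j).
have geq_trans : transitive geq by move=> a b c /= ab bc; apply: leq_trans bc ab.
have geq_refl : reflexive geq by move=> a /=.
apply: (sorted_leq_nth geq_trans geq_refl 0%N la_s); rewrite ?inE; lia.
Qed.

Lemma sum_parts la t : (size la <= t)%N ->
  (\sum_(i < t) part la i.+1 = sumn la)%N.
Proof.
move=> le_t; rewrite sumnE (big_nth 0%N) big_mkord.
rewrite (big_ord_widen _ (nth 0%N la) le_t) [RHS]big_mkcond /=.
apply: eq_bigr => i _; case: ltnP => // ge_i.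
by rewrite /part nth_default.
Qed.

Lemma mem_diagram la u : (u \in young_diagram la) =
  [&& 0 < u.1, u.1 <= size la, 0 < u.2 & u.2 <= part la u.1]%N.
Proof.
apply/allpairsPdep/idP => [[i [j [+ + ->]]]|].
  by rewrite !mem_iota /=; lia.
by case: u => a b /= H; exists a, b; split => //; rewrite mem_iota; lia.
Qed.

Lemma uniq_diagram la : uniq (young_diagram la).
Proof.
apply: allpairs_uniq_dep => [|i _|]; try exact: iota_uniq.
by move=> [i j] [i' j'] _ _ /= [-> ->].
Qed.

Lemma size_diagram la : size (young_diagram la) = sumn la.
Proof.
rewrite size_allpairs_dep -(sum_parts (leqnn (size la))).
rewrite sumnE big_map -[iota 1 _]/(iota (1 + 0) _) iotaDl big_map.
by rewrite -{1}[size la]subn0 -/(index_iota 0 _) big_mkord;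
  apply: eq_bigr => i _; rewrite size_iota.
Qed.

(** In this form it is clear that each square lies in exactly one hook. *)
Lemma diag_hookE la k :
  diag_hook la k = [seq u <- young_diagram la | minn u.1 u.2 == k].
Proof. by apply: eq_filter => u /=; lia. Qed.

Lemma sum_diag_hooks la t : (size la <= t)%N ->
  (\sum_(i < t) size (diag_hook la (t - i.+1 + 1)) = sumn la)%N.
Proof.
move=> le_t; rewrite (reindex_inj rev_ord_inj) /= -size_diagram.
under eq_bigr => i _ do rewrite diag_hookE size_filter -sum1_count big_mkcond /=.
rewrite exchange_big -sum1_size big_seq [RHS]big_seq.
apply: eq_bigr => -[a b]; rewrite mem_diagram /= => ab_in.
have lt_u : ((minn a b).-1 < t)%N by lia.
rewrite (bigD1 (Ordinal lt_u)) //= big1 => [|i]; last first.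
  by rewrite -val_eqE /= => ne; rewrite ifF //; have := ltn_ord i; lia.
by rewrite addn0 ifT //; lia.
Qed.

(** Contents are nonnegative on the arm of the hook and negative on its leg, and
    on each of the two they determine the square. *)
Lemma uniq_hook_contents la k : uniq [seq content u | u <- diag_hook la k].
Proof.
rewrite map_inj_in_uniq ?filter_uniq ?uniq_diagram //.
move=> [a b] [a' b']; rewrite !mem_filter /content /=.
by move=> /andP[h _] /andP[h' _] e; congr pair; lia.
Qed.

(** * Powers of q *)

Lemma q_neq0 : q != 0.
Proof. by rewrite /q tofrac_eq0 polyX_eq0. Qed.

Lemma subr1_qX n : (0 < n)%N -> 1 - q ^+ n != 0.
Proof.
move=> n_gt0; rewrite subr_eq0 /q -tofracXn -tofrac1 tofrac_eq.
apply/eqP => /(congr1 (fun p : {poly rat} => size p)).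
by rewrite size_polyXn size_poly1; case: n n_gt0.
Qed.

Lemma q_exp_inj : injective (fun c : int => q ^ c).
Proof.
suff inj n : q ^ (n : int) = 1 -> n = 0.
  move=> a b /= e; apply/eqP; rewrite -subr_eq0; apply/eqP/inj.
  by rewrite expfzDr ?q_neq0 // -invr_expz e mulfV // expfz_neq0 ?q_neq0.
case: n => [[//|n]|n] /eqP; rewrite ?NegzE.
  by rewrite -exprnP eq_sym -subr_eq0 (negPf (subr1_qX _)).
by rewrite -invr_expz -exprnP invr_eq1 eq_sym -subr_eq0 (negPf (subr1_qX _)).
Qed.

(** The q-factorial of [m], multiplied by [(1 - q)^m]. *)
Definition qfact m := \prod_(1 <= i < m.+1) (1 - q ^+ i).

Lemma qfact_neq0 m : qfact m != 0.
Proof.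
rewrite /qfact big_add1 /= big_mkord; apply/prodf_neq0 => i _; exact: subr1_qX.
Qed.

Lemma qfactD m k :
  qfact (m + k) = qfact m * \prod_(0 <= i < k) (1 - q ^+ (m.+1 + i)).
Proof.
elim: k => [|k IH]; first by rewrite big_geq // addn0 mulr1.
rewrite addnS {1}/qfact big_nat_recr //= -/(qfact _) IH.
by rewrite big_nat_recr //= mulrA addSn.
Qed.

(** * Values of g *)

Lemma horner_g (m : nat) x :
  (g m).[x] = (qfact m)^-1 * \prod_(0 <= i < m) (1 - q ^+ i * x).
Proof.
rewrite /g /= hornerZ horner_prod; congr (_ * _); apply: eq_bigr => i _.
by rewrite hornerD hornerN hornerZ hornerC hornerX.
Qed.

Lemma size_prod_affine (F : fieldType) (a : nat -> F) m :
  (size (\prod_(0 <= i < m) (1 - a i *: 'X))%R <= m.+1)%N.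
Proof.
rewrite big_mkord; apply: leq_trans (size_poly_prod_leq _ _) _.
rewrite card_ord leq_subLR addnS ltnS.
apply: (@leq_trans (\sum_(i < m) 2)); last by rewrite sum_nat_const card_ord; lia.
apply: leq_sum => i _; apply: leq_trans (size_polyD _ _) _.
rewrite size_poly1 size_polyN geq_max /=.
by apply: leq_trans (size_scale_leq _ _) _; rewrite size_polyX.
Qed.

Lemma size_g (m : nat) : (size (g m) <= m.+1)%N.
Proof. by apply: leq_trans (size_scale_leq _ _) (size_prod_affine _ _). Qed.

Lemma g_root (c : nat) (m : int) : c%:Z < m -> (g m).[q ^ (- c%:Z)] = 0.
Proof.
case: m => // m lt_cm; rewrite horner_g (bigD1_seq c) ?iota_uniq //=; last first.
  by rewrite mem_index_iota; lia.
by rewrite exprnP -expfzDr ?q_neq0 // subrr subrr mul0r mulr0.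
Qed.

(** At [q^m], for [m >= 0], this polynomial takes as value the q-binomial
    coefficient of [m + d] over [d]. *)
Definition q_binomial_poly (d : nat) : {poly Qq} :=
  (qfact d)^-1 *: \prod_(0 <= i < d) (1 - q ^+ i.+1 *: 'X).

Lemma size_q_binomial_poly d : (size (q_binomial_poly d) <= d.+1)%N.
Proof.
exact: leq_trans (size_scale_leq _ _) (size_prod_affine (fun i => q ^+ i.+1) _).
Qed.

(** The substitution [y = q^(d + 1)] makes [g m] the complete homogeneous
    polynomial of degree [m] in [1, q, ..., q^d].  The formula survives for
    negative [m >= - d], where both sides vanish; the rank bound relies on that
    range. *)
Lemma g_q_binomial (d : nat) (m : int) : - d%:Z <= m ->
  (g m).[q ^+ d.+1] = (q_binomial_poly d).[q ^ m].
Proof.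
move=> le_dm; rewrite hornerZ horner_prod.
under [in RHS]eq_bigr => i _ do
  rewrite hornerD hornerN hornerZ hornerC hornerX exprnP -expfzDr ?q_neq0 //.
case: m le_dm => [m _|m le_dm].
  (* Both sides times [qfact m * qfact d] are [qfact (m + d)]. *)
  rewrite horner_g; apply: (canLR (mulKf (qfact_neq0 m))); rewrite mulrCA.
  apply: (canRL (mulKf (qfact_neq0 d))).
  have := qfactD m d; rewrite addnC qfactD.
  under eq_bigr => i _ do rewrite addnC exprD.
  under [in X in _ = X -> _]eq_bigr => i _ do rewrite addSnnS addnC exprnP PoszD.
  by [].
rewrite horner0 (bigD1_seq m) ?iota_uniq //=; last by rewrite mem_index_iota; lia.
by rewrite NegzE subrr subrr mul0r mulr0.
Qed.

(** * Rank drops at powers of q *)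

Lemma rank_le_of_top_rows (F : fieldType) t r d
    (M : 'M[F]_t) (A : 'M_(t, d)) (B : 'M_(d, t)) : (r <= t)%N ->
  (forall i j : 'I_t, (i < r)%N -> M i j = (A *m B) i j) ->
  (\rank M <= d + (t - r))%N.
Proof.
move=> le_r topM.
have -> : M = pid_mx r *m (A *m B) + copid_mx r *m M.
  rewrite mulmxBl mul1mx addrCA addrC.
  suff -> : (pid_mx r : 'M_t) *m (A *m B) = pid_mx r *m M by rewrite subrr add0r.
  apply/matrixP => i j; rewrite !mxE; apply: eq_bigr => k _; rewrite [in LHS]mxE.
  rewrite [in RHS]mxE; case: andP => [[/eqP ik lt_i]|_]; last by rewrite !mul0r.
  by rewrite topM // -ik.
apply: leq_trans (mxrank_add _ _) _; apply: leq_add.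
  by rewrite mulmxA; apply: mulmx_max_rank.
by rewrite -(rank_copid_mx F le_r); apply: mxrankM_maxl.
Qed.

(** For a square on the arm of the hook the first [k] rows vanish.  For a square
    [(k + d, k)] on the leg, the indices of [g] in the first [k + d] rows are
    greater than [- d], where [g] takes the values of a polynomial of degree
    less than [d] in [q^m]; expanding it in powers of [q^m], with
    [m = (la_i - i) + j], separates [i] from [j] and factors these rows through
    dimension [d]. *)
Lemma rank_jt_root la t k u : sorted geq la -> (size la <= t)%N ->
  u \in diag_hook la k ->
  (\rank (map_mx (horner_eval (q ^ (- content u))) (jt_matrix la t)) <= t - k)%N.
Proof.
move=> la_s le_t; rewrite diag_hookE mem_filter mem_diagram.
case: u => a b /= /andP[/eqP <- {k} ab_in]; rewrite /content /=.
have part_ge i : (i < a)%N -> (b <= part la i.+1)%N.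
  by move=> lt_i; apply: (@leq_trans (part la a)); [lia | apply: part_anti].
case: (leqP a b) => [le_ab | lt_ba].
  apply: (@rank_le_of_top_rows _ _ a 0 _ 0 0) => [|i j lt_ia]; first by lia.
  have -> : b%:Z - a%:Z = (b - a)%N by lia.
  rewrite mulmx0 !mxE /horner_eval g_root //.
  have := part_ge i lt_ia; lia.
(* The content is [- d.+1]: this is the [d] of [g_q_binomial]. *)
pose d := (a - b).-1; have Ed : (a - b)%N = d.+1 by rewrite /d; lia.
pose p := q_binomial_poly d.
pose A := \matrix_(i < t, s < d.+1)
  (p`_s * (q ^ ((part la i.+1)%:Z - (i.+1)%:Z)) ^+ s).
pose B := \matrix_(s < d.+1, j < t) (q ^ (j.+1)%:Z) ^+ s.
have -> : (t - b = d.+1 + (t - a))%N by lia.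
apply: (rank_le_of_top_rows (A := A) (B := B)) => [|i j lt_ia]; first by lia.
have -> : - (b%:Z - a%:Z) = (d.+1)%:Z by lia.
rewrite !mxE /horner_eval -exprnP g_q_binomial; last first.
  have := part_ge i lt_ia; lia.
rewrite (horner_coef_wide _ (size_q_binomial_poly d)); apply: eq_bigr => s _.
by rewrite !mxE -mulrA -exprMn -expfzDr ?q_neq0.
Qed.

(** * Nonvanishing of the determinant *)

(** The value at [q^mu] is [qfact mu / qfact (mu - s)] when [s <= mu], and 0
    otherwise: a q-analogue of the falling factorial. *)
Definition falling_poly s : {poly Qq} :=
  \prod_(0 <= r < s) (1 - q ^ (- r%:Z) *: 'X).

Lemma size_falling_poly s : size (falling_poly s) = s.+1.
Proof.
rewrite /falling_poly; elim: s => [|s IH]; first by rewrite big_geq // size_poly1.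
have sz : size (1 - q ^ (- s%:Z) *: 'X : {poly Qq}) = 2%N.
  rewrite addrC size_polyDl size_polyN size_scale ?expfz_neq0 ?q_neq0 //.
    by rewrite size_polyX.
  by rewrite size_polyX size_poly1.
have nz_p : \prod_(0 <= r < s) (1 - q ^ (- r%:Z) *: 'X : {poly Qq}) != 0.
  by rewrite -size_poly_eq0 IH.
by rewrite big_nat_recr //= size_mul ?IH ?sz ?addn2 // -size_poly_eq0 sz.
Qed.

Lemma g0_pred (m : int) : (g (m - 1)).[0] = (g m).[0] * (1 - q ^ m).
Proof.
have g0 (n : nat) : (g n).[0] = (qfact n)^-1.
  by rewrite horner_g big1 ?mulr1 // => i _; rewrite mulr0 subr0.
case: m => [[|n]|n].
- by rewrite expr0z subrr mulr0 horner0.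
- rewrite (_ : n.+1%:Z - 1 = n%:Z) ?g0; last by lia.
  rewrite -(addn1 n) qfactD big_nat1 addn0 addn1 -exprnP invfM.
  rewrite -mulrA mulVf ?mulr1 //.
  exact: subr1_qX.
- by rewrite (_ : Negz n - 1 = Negz n.+1) ?horner0 ?mul0r //; lia.
Qed.

Lemma g0_falling (mu s : nat) :
  (g (mu%:Z - s%:Z)).[0] = (qfact mu)^-1 * (falling_poly s).[q ^+ mu].
Proof.
elim: s => [|s IH].
  rewrite subr0 /falling_poly big_geq // hornerC horner_g big1 // => i _.
  by rewrite mulr0 subr0.
rewrite (_ : mu%:Z - s.+1%:Z = mu%:Z - s%:Z - 1); last by lia.
rewrite g0_pred IH /falling_poly big_nat_recr //= hornerM -mulrA.
congr (_ * (_ * _)).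
rewrite hornerD hornerN hornerZ hornerC hornerX exprnP -expfzDr ?q_neq0 //.
by rewrite [- _ + _]addrC.
Qed.

(** Vandermonde determinants for polynomials of degrees [t - 1, ..., 1, 0]: a
    linear relation between the columns is a combination of the polynomials
    with [t] roots and degree less than [t], hence zero, and distinct degrees
    then force the coefficients to vanish. *)
Lemma det_poly_basis_neq0 (F : fieldType) t
    (W : nat -> {poly F}) (z : 'I_t -> F) :
  (forall s, size (W s) = s.+1) -> injective z ->
  \det (\matrix_(i < t, j < t) (W (t - j.+1)%N).[z i]) != 0.
Proof.
move=> sz_W z_inj; rewrite -det_tr; apply/det0P => -[v nz_v vW].
pose p := \sum_(j < t) v 0 j *: W (t - j.+1)%N.
have p0 : p = 0.
  apply/eqP/negPn/negP => nz_p.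
  have : (size [seq z i | i : 'I_t] < size p)%N.
    apply: max_poly_roots => //; last by rewrite map_inj_uniq ?enum_uniq.
    apply/allP => _ /imageP[i _ ->]; rewrite /root; apply/eqP.
    have /rowP/(_ i) := vW; rewrite !mxE => <-.
    rewrite /p horner_sum; apply: eq_bigr => j _; by rewrite !mxE hornerZ.
  apply/negP; rewrite -leqNgt size_map size_enum_ord.
  apply: leq_trans (size_sum _ _ _) _; apply/bigmax_leqP => j _.
  by apply: leq_trans (size_scale_leq _ _) _; rewrite sz_W; have := ltn_ord j; lia.
(* The first nonzero coefficient of the relation carries the largest degree. *)
have /rV0Pn [j0 nz_j0] := nz_v.
case: (@arg_minnP _ j0 (fun j => v 0 j != 0) (@nat_of_ord t) nz_j0) => j nz_j min_j.
have : p`_(t - j.+1) = 0 by rewrite p0 coef0.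
rewrite coef_sum (bigD1 j) //= big1 => [|k ne_kj].
  rewrite addr0 coefZ => /eqP; rewrite mulf_eq0 (negPf nz_j) /=.
  have := lead_coef_eq0 (W (t - j.+1)%N); rewrite lead_coefE sz_W /= => ->.
  by rewrite -size_poly_eq0 sz_W.
rewrite coefZ; have [->|nz_k] := eqVneq (v 0 k) 0; first by rewrite mul0r.
rewrite nth_default ?mulr0 // sz_W.
have := min_j k nz_k; have := ltn_ord k; move: ne_kj; rewrite -val_eqE /=; lia.
Qed.

(** At [y = 0] the entry in row [i] and column [j] is the inverse of
    [qfact (mu i - (t - j))], and 0 for a negative index.  The strictly
    decreasing sequence [mu] makes the points [q^(mu i)] distinct. *)
Lemma det_jt_neq0 la t : sorted geq la -> \det (jt_matrix la t) != 0.
Proof.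
move=> la_s; apply/eqP => det0.
have : \det (map_mx (horner_eval 0) (jt_matrix la t)) = 0.
  by rewrite det_map_mx det0 /= /horner_eval horner0.
pose mu (i : 'I_t) := (part la i.+1 + t - i.+1)%N.
have -> : map_mx (horner_eval 0) (jt_matrix la t) =
    diag_mx (\row_i (qfact (mu i))^-1) *m
    \matrix_(i < t, j < t) (falling_poly (t - j.+1)%N).[q ^+ mu i].
  apply/matrixP => i j; rewrite mul_diag_mx !mxE -g0_falling /horner_eval.
  by congr (g _).[0]; have := ltn_ord i; have := ltn_ord j; rewrite /mu; lia.
apply/eqP; rewrite det_mulmx det_diag mulf_neq0 //.
  by apply/prodf_neq0 => i _; rewrite mxE invr_neq0 ?qfact_neq0.
apply: det_poly_basis_neq0 => [|i i' /=]; first exact: size_falling_poly.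
rewrite !exprnP => /q_exp_inj [] e; apply: val_inj => /=.
have := ltn_ord i; have := ltn_ord i'.
case: (ltngtP i i') => // lt_i.
  have := @part_anti la i.+1 i'.+1 la_s isT (ltnW lt_i);
    move: e; rewrite /mu; lia.
have := @part_anti la i'.+1 i.+1 la_s isT (ltnW lt_i);
    move: e; rewrite /mu; lia.
Qed.

(** * Degrees *)

(** Along a permutation [s] the degrees add up to the sum of
    [la_i - i + s(i)], which is [|la|]. *)
Lemma size_det_jt la t : (size la <= t)%N ->
  (size (\det (jt_matrix la t)) <= (sumn la).+1)%N.
Proof.
move=> le_t; apply: leq_trans (size_sum _ _ _) _; apply/bigmax_leqP => s _.
rewrite size_Msign.
pose m (i : 'I_t) : int := (part la i.+1)%:Z - i.+1%:Z + (s i).+1%:Z.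
have -> : \prod_i jt_matrix la t i (s i) = \prod_i g (m i).
  by apply: eq_bigr => i _; rewrite mxE.
have [/forallP m_ge0|] := boolP [forall i, 0 <= m i]; last first.
  rewrite negb_forall => /existsP[i]; rewrite -ltNge => lt_m.
  rewrite (bigD1 i) //= (_ : g (m i) = 0) ?mul0r ?size_poly0 //.
  by case: (m i) lt_m.
apply: leq_trans (size_poly_prod_leq _ _) _.
rewrite card_ord leq_subLR addnS ltnS.
apply: (@leq_trans (\sum_(i < t) (`|m i| + 1))%N).
  apply: leq_sum => i _; have := m_ge0 i; case: (m i) => // n _.
  by rewrite addn1 size_g.
rewrite big_split /= sum_nat_const card_ord muln1 addnC leq_add2l.
rewrite -(sum_parts le_t) -lez_nat.
have natz_sum (f : 'I_t -> nat) : ((\sum_i f i)%N : int) = \sum_i (f i : int).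
  by apply: big_morph.
rewrite !natz_sum.
have -> : \sum_i (`|m i|%N : int) = \sum_i m i.
  by apply: eq_bigr => i _; have := m_ge0 i; lia.
have s_sum : \sum_(i < t) (s i).+1%:Z = \sum_(i < t) i.+1%:Z.
  by rewrite [RHS](reindex_perm s).
by rewrite /m big_split sumrB /= s_sum subrK.
Qed.

Lemma hook_prod_eqp la k : hook_prod la k %=
  \prod_(z <- [seq q ^ (- content u) | u <- diag_hook la k]) ('X - z%:P).
Proof.
rewrite big_map; apply: (big_ind2 (fun p r : {poly Qq} => p %= r)).
- exact: eqpxx.
- by move=> p p' r r' e e'; apply: eqp_trans (eqp_mulr _ e) (eqp_mull _ e').
move=> u _.
have -> : 1 - q ^ content u *: y =
    - q ^ content u *: ('X - (q ^ (- content u))%:P).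
  rewrite scalerBr -[X in _ = _ - X]mul_polyC -polyCM mulNr -expfzDr ?q_neq0 //.
  by rewrite subrr expr0z polyCN opprK scaleNr addrC.
by apply: eqp_scale; rewrite oppr_eq0 expfz_neq0 ?q_neq0.
Qed.

Lemma size_hook_prod la k :
  size (hook_prod la k) = (size (diag_hook la k)).+1.
Proof. by rewrite (eqp_size (hook_prod_eqp _ _)) size_prod_XsubC size_map. Qed.

Lemma size_prod_hook_prod la t : (size la <= t)%N ->
  size (\prod_(i < t) hook_prod la (t - i.+1 + 1)) = (sumn la).+1.
Proof.
move=> le_t; rewrite size_prod => [|i _].
  under eq_bigr => i _ do rewrite size_hook_prod -addn1.
  by rewrite big_split /= sum_nat_const card_ord muln1 sum_diag_hooks //; lia.
by rewrite -size_poly_eq0 size_hook_prod.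
Qed.

(** * The Smith normal form of the Jacobi-Trudi matrix *)

Theorem theorem3p1 (n : nat) (la : seq nat) (t : nat)
  (n_gt0 : (0 < n)%N)
  (la_part : is_partition_of n la)
  (le_t : (size la <= t)%N) :
  is_smith_normal_form (jt_matrix la t)
    (diag_mx (\row_(i < t) hook_prod la (t - i.+1 + 1)%N)).
Proof.
have /and3P[la_s _ _] := la_part.
apply: (smith_of_ranks (det_jt_neq0 t la_s) _
  (fun i => hook_prod_eqp la (t - i.+1 + 1))).
- by rewrite size_prod_hook_prod ?size_det_jt.
- move=> i; rewrite (map_comp (fun c => q ^ (- c)) content) map_inj_uniq.
    exact: uniq_hook_contents.
  by move=> c c' /q_exp_inj /oppr_inj.
- move=> i z /mapP[u u_in ->].
  apply: leq_trans (rank_jt_root la_s le_t u_in) _; have := ltn_ord i; lia.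
Qed.
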